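(* If $n\geq 18$, then every permutation $p\in S_n$ has a monotone $2$-additive subsequence of length three.
   Context: $S_n$ denotes the set of permutations of $\{1,2,\ldots,n\}$ written in one-line notation $p=(p_1,p_2,\ldots,p_n)$. A subsequence of $p$ of length $k$ is a sequence $(p_{i_1},\ldots,p_{i_k})$ with $i_1<\cdots<i_k$. A sequence is monotone if it is increasing or decreasing. A sequence $(a_1,a_2,\ldots,a_k)$ of positive integers is $2$-additive if $a_1+a_2+\cdots+a_k=2a_1$ or $a_1+a_2+\cdots+a_k=2a_k$. *)

(* Defs.v *)
From mathcomp Require Import all_boot all_fingroup.

Set Implicit Arguments.
Unset Strict Implicit.
Unset Printing Implicit Defensive.

(* 'S_n permutes 'I_n = {0, ..., n-1}; each value is shifted by one so that
   the one-line notation (p_1, ..., p_n) is a word on {1, ..., n}. *)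
Definition one_line (n : nat) (p : 'S_n) : seq nat :=
  [seq (p i).+1 | i <- enum 'I_n].

Definition monotone_seq (s : seq nat) : bool := sorted ltn s || sorted gtn s.

(* A 2-additive sequence (a_1, ..., a_k) has first and last terms, so k >= 1. *)
Definition two_additive (s : seq nat) : bool :=
  if s is a :: s' then
    (sumn s == 2 * a) || (sumn s == 2 * last a s')
  else false.

(* Main.v *)
Require Import Defs.
From mathcomp Require Import all_boot all_fingroup.

(** Three positive values form a monotone 2-additive subsequence exactly when,
    for some a < b, they are a, b and a + b, with b standing between a and
    a + b in the word: the extreme term that is the sum of the other two is
    then at one end and the middle value in the middle.  So in a word without
    such a subsequence, every b sees a and a + b on the same side of itself,
    for all a < b with a + b <= n.  The rest of the argument uses nothing but
    this property of the left-to-right order of the values ([side_order]): the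
    place of b relative to a and its place relative to a + b determine each
    other.

    These equivalences chain up.  If 1 stands before 2, then so does 3; now
    3 stands before 2, hence before 5; then 8 stands before 5, hence before
    13.  Mixed with transitivity, such chains leave very little freedom.
    Reversing a word preserves the condition, so 1 may be assumed to stand
    before 2.  After that it is enough to decide whether 3 stands before or
    after 1, and in the second case whether 7 stands before or after 1: each of
    the three resulting cases forces two values to precede each other
    ([no_side_order_13], [no_side_order_31_17], [no_side_order_31_71]).
    All values involved are at most 18, so the values 1, ..., 18 of a longer
    permutation already yield the contradiction. *)

(** * Orders in which b sees a and a + b on the same side *)

(** The order [r x y] is meant as: x stands to the left of y in the word. *)
Record side_order (N : nat) (r : rel nat) : Prop := SideOrder {
  side_irr : irreflexive r;
  side_trans : forall x y z, r x y -> r y z -> r x z;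
  side_total : forall x y, 0 < x <= N -> 0 < y <= N -> x != y -> r x y || r y x;
  side_same : forall a b, 0 < a < b -> a + b <= N ->
    r a b = r (a + b) b /\ r b a = r b (a + b)
}.

Arguments side_irr {N r}.
Arguments side_trans {N r} _ {x y z}.
Arguments side_total {N r}.
Arguments side_same {N r}.

Lemma side_asym {N r x y} : side_order N r -> r x y -> r y x -> False.
Proof. by move=> H rxy /(side_trans H rxy); rewrite (side_irr H). Qed.

Lemma side_order_rev {N r} :
  side_order N r -> side_order N (fun x y => r y x).
Proof.
  move=> H; split=> [x|x y z ryx rzy|x y hx hy hxy|a b hab hN].
  - exact: side_irr H x.
  - exact: (side_trans H rzy ryx).
  - by rewrite orbC (side_total H).
  - by have [-> ->] := side_same H a b hab hN.
Qed.

(** The equivalence at b is used in both directions, from a to a + b and back,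
    so [x] and [y] play symmetric roles. *)
Definition exchangeable (N b x y : nat) : bool :=
  [&& 0 < x < b, y == x + b & y <= N] || [&& 0 < y < b, x == y + b & x <= N].

Lemma step_left {N r} (H : side_order N r) {x y b} :
  r x b -> exchangeable N b x y -> r y b.
Proof.
  move=> rxb /orP[] /and3P[h /eqP E hN].
  - by rewrite E in hN *; rewrite -(side_same H _ _ h hN).1.
  - by rewrite E in rxb hN; rewrite (side_same H _ _ h hN).1.
Qed.

(* Unifying with the expected conclusion first fixes y, so that the side
   condition can then be checked by computation. *)
Arguments step_left {N r} H {x y b} &.

Lemma step_right {N r} (H : side_order N r) {x y b} :
  r b x -> exchangeable N b x y -> r b y.
Proof. by move=> rbx; apply: (step_left (side_order_rev H) rbx). Qed.

Arguments step_right {N r} H {x y b} &.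

(** * No such order exists on 1, ..., 18 *)

(** The contradiction is the cycle 8, 13, 9, 14, 8.  Its first step comes from
    1 before 2 alone, as in the chain through 3, 5, 8, 13.  The position of 1
    before 3 adds 4 before 3, and combining the two puts 4 before 5, hence 9
    before 14, and 6 before 1, from which the remaining two steps follow. *)
Lemma no_side_order_13 {r} : side_order 18 r -> r 1 2 -> r 1 3 -> False.
Proof.
  move=> H r1_2 r1_3.
  have r3_2 : r 3 2 := step_left H r1_2 isT.
  have r3_5 : r 3 5 := step_right H r3_2 isT.
  have r8_5 : r 8 5 := step_left H r3_5 isT.
  have r8_13 : r 8 13 := step_right H r8_5 isT.
  have r4_3 : r 4 3 := step_left H r1_3 isT.
  have r4_2 : r 4 2 := side_trans H r4_3 r3_2.
  have r4_6 : r 4 6 := step_right H r4_2 isT.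
  have r1_5 : r 1 5 := side_trans H r1_3 r3_5.
  have r6_5 : r 6 5 := step_left H r1_5 isT.
  have r6_11 : r 6 11 := step_right H r6_5 isT.
  have r4_7 : r 4 7 := step_right H r4_3 isT.
  have r11_7 : r 11 7 := step_left H r4_7 isT.
  have r6_7 : r 6 7 := side_trans H r6_11 r11_7.
  have r6_1 : r 6 1 := step_right H r6_7 isT.
  have r6_3 : r 6 3 := side_trans H r6_1 r1_3.
  have r6_9 : r 6 9 := step_right H r6_3 isT.
  have r4_9 : r 4 9 := side_trans H r4_6 r6_9.
  have r13_9 : r 13 9 := step_left H r4_9 isT.
  have r8_9 : r 8 9 := side_trans H r8_13 r13_9.
  have r4_5 : r 4 5 := side_trans H r4_3 r3_5.
  have r9_5 : r 9 5 := step_left H r4_5 isT.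
  have r9_14 : r 9 14 := step_right H r9_5 isT.
  have r6_2 : r 6 2 := side_trans H r6_1 r1_2.
  have r6_8 : r 6 8 := step_right H r6_2 isT.
  have r14_8 : r 14 8 := step_left H r6_8 isT.
  have r9_8 : r 9 8 := side_trans H r9_14 r14_8.
  exact: (side_asym H r8_9 r9_8).
Qed.

(** The contradiction is the cycle 14, 9, 15, 14.  The order 3, 1, 7, 4 drives
    everything: 1 before 4 gives 14 before 9 through 5, while 3 before 7 gives
    10 before 7, hence before 4, hence before 14.  The values 8 and 18 precede
    10 and therefore 14 as well; 8 before 14 leads through 6 to 9 before 15, and
    18 before 14 leads through 4 and 1 to 15 before 14. *)
Lemma no_side_order_31_17 {r} :
  side_order 18 r -> r 1 2 -> r 3 1 -> r 1 7 -> False.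
Proof.
  move=> H r1_2 r3_1 r1_7.
  have r3_4 : r 3 4 := step_right H r3_1 isT.
  have r7_4 : r 7 4 := step_left H r3_4 isT.
  have r1_4 : r 1 4 := side_trans H r1_7 r7_4.
  have r5_4 : r 5 4 := step_left H r1_4 isT.
  have r5_9 : r 5 9 := step_right H r5_4 isT.
  have r14_9 : r 14 9 := step_left H r5_9 isT.
  have r3_2 : r 3 2 := step_left H r1_2 isT.
  have r8_7 : r 8 7 := step_left H r1_7 isT.
  have r7_11 : r 7 11 := step_right H r7_4 isT.
  have r8_11 : r 8 11 := side_trans H r8_7 r7_11.
  have r8_3 : r 8 3 := step_right H r8_11 isT.
  have r8_2 : r 8 2 := side_trans H r8_3 r3_2.
  have r8_10 : r 8 10 := step_right H r8_2 isT.
  have r3_7 : r 3 7 := side_trans H r3_1 r1_7.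
  have r10_7 : r 10 7 := step_left H r3_7 isT.
  have r10_4 : r 10 4 := side_trans H r10_7 r7_4.
  have r10_14 : r 10 14 := step_right H r10_4 isT.
  have r8_14 : r 8 14 := side_trans H r8_10 r10_14.
  have r8_6 : r 8 6 := step_right H r8_14 isT.
  have r2_6 : r 2 6 := step_left H r8_6 isT.
  have r3_6 : r 3 6 := side_trans H r3_2 r2_6.
  have r9_6 : r 9 6 := step_left H r3_6 isT.
  have r9_15 : r 9 15 := step_right H r9_6 isT.
  have r14_15 : r 14 15 := side_trans H r14_9 r9_15.
  have r18_10 : r 18 10 := step_left H r8_10 isT.
  have r18_14 : r 18 14 := side_trans H r18_10 r10_14.
  have r4_14 : r 4 14 := step_left H r18_14 isT.
  have r1_14 : r 1 14 := side_trans H r1_4 r4_14.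
  have r15_14 : r 15 14 := step_left H r1_14 isT.
  exact: (side_asym H r14_15 r15_14).
Qed.

(** The contradiction is the cycle 16, 6, 11, 16. The value 7 precedes 8 and
    13, and going from 13 down to 6, then from 7 down to 1, puts 1 before 6;
    then 3, 9 and 16 also precede 6. From 9 before 6 one gets 9 before 15
    before 8, so that 1, 3 and 11 precede 8, which precedes 5, and 11 before 5
    gives 11 before 16. *)
Lemma no_side_order_31_71 {r} :
  side_order 18 r -> r 1 2 -> r 3 1 -> r 7 1 -> False.
Proof.
  move=> H r1_2 r3_1 r7_1.
  have r7_2 : r 7 2 := side_trans H r7_1 r1_2.
  have r7_9 : r 7 9 := step_right H r7_2 isT.
  have r16_9 : r 16 9 := step_left H r7_9 isT.
  have r7_8 : r 7 8 := step_right H r7_1 isT.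
  have r3_2 : r 3 2 := step_left H r1_2 isT.
  have r3_5 : r 3 5 := step_right H r3_2 isT.
  have r8_5 : r 8 5 := step_left H r3_5 isT.
  have r8_13 : r 8 13 := step_right H r8_5 isT.
  have r7_13 : r 7 13 := side_trans H r7_8 r8_13.
  have r7_6 : r 7 6 := step_right H r7_13 isT.
  have r1_6 : r 1 6 := step_left H r7_6 isT.
  have r3_6 : r 3 6 := side_trans H r3_1 r1_6.
  have r9_6 : r 9 6 := step_left H r3_6 isT.
  have r16_6 : r 16 6 := side_trans H r16_9 r9_6.
  have r7_5 : r 7 5 := side_trans H r7_8 r8_5.
  have r2_5 : r 2 5 := step_left H r7_5 isT.
  have r1_5 : r 1 5 := side_trans H r1_2 r2_5.
  have r6_5 : r 6 5 := step_left H r1_5 isT.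
  have r6_11 : r 6 11 := step_right H r6_5 isT.
  have r16_11 : r 16 11 := side_trans H r16_6 r6_11.
  have r9_15 : r 9 15 := step_right H r9_6 isT.
  have r15_8 : r 15 8 := step_left H r7_8 isT.
  have r9_8 : r 9 8 := side_trans H r9_15 r15_8.
  have r1_8 : r 1 8 := step_left H r9_8 isT.
  have r3_8 : r 3 8 := side_trans H r3_1 r1_8.
  have r11_8 : r 11 8 := step_left H r3_8 isT.
  have r11_5 : r 11 5 := side_trans H r11_8 r8_5.
  have r11_16 : r 11 16 := step_right H r11_5 isT.
  exact: (side_asym H r16_11 r11_16).
Qed.

Lemma no_side_order {r} : ~ side_order 18 r.
Proof.
  suff no12 q : side_order 18 q -> q 1 2 -> False.
    move=> H; case/orP: (side_total H 1 2 isT isT isT); first exact: no12.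
    exact: (no12 _ (side_order_rev H)).
  move=> H q12; case/orP: (side_total H 1 3 isT isT isT) => [q13|q31].
    exact: (no_side_order_13 H q12 q13).
  case/orP: (side_total H 1 7 isT isT isT) => [q17|q71].
    exact: (no_side_order_31_17 H q12 q31 q17).
  exact: (no_side_order_31_71 H q12 q31 q71).
Qed.

(** * From positions in a word to subsequences *)

Definition left_of (w : seq nat) : rel nat :=
  fun x y => index x w < index y w.

Definition between (r : rel nat) (x y z : nat) : bool :=
  r x y && r y z || r z y && r y x.

Lemma left_of_sorted {w} : uniq w -> sorted (left_of w) w.
Proof.
  move=> uw; apply/(sortedP 0) => i hi.
  by rewrite /left_of !index_uniq // ltnW.
Qed.

(** Both [s] and the part of [w] with entries in [s] are enumerations of the
    same set in increasing order of position, so they coincide. *)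
Lemma subseq_left_of {w s} :
  uniq w -> {subset s <= w} -> sorted (left_of w) s -> subseq s w.
Proof.
  move=> uw sw ss.
  have tr : transitive (left_of w) by move=> y x z; apply: ltn_trans.
  suff -> : s = [seq x <- w | x \in s] by apply: filter_subseq.
  apply: (irr_sorted_eq tr) => // [x||x].
  - exact: ltnn.
  - exact/sorted_filter/left_of_sorted.
  - by rewrite mem_filter; case: (boolP (x \in s)) => [/sw|].
Qed.

Lemma between_two_additive {w a b} :
  uniq w -> {subset [:: a; b; a + b] <= w} -> 0 < a < b ->
  between (left_of w) a b (a + b) ->
  exists s : seq nat,
    [/\ subseq s w, size s = 3, monotone_seq s & two_additive s].
Proof.
  move=> uw sub /andP[a0 ab] btw.
  have bab : b < a + b by rewrite -[X in X < _]add0n ltn_add2r.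
  case/orP: btw => /andP[h1 h2].
  - exists [:: a; b; a + b]; split=> //.
    + by apply: subseq_left_of; rewrite //= h1 h2.
    + by rewrite /monotone_seq /= ab bab.
    + by rewrite /= addn0 addnA !mul2n -!addnn eqxx orbT.
  - exists [:: a + b; b; a]; split=> //.
    + apply: subseq_left_of; rewrite //= ?h1 ?h2 // => x.
      by rewrite -mem_rev => /sub.
    + by rewrite /monotone_seq /= ab bab orbT.
    + by rewrite /= addn0 [b + a]addnC mul2n -addnn eqxx.
Qed.

Lemma side_order_left_of {w : seq nat} {N} :
  {subset [pred v | 0 < v <= N] <= w} ->
  (forall a b, 0 < a < b -> a + b <= N -> ~~ between (left_of w) a b (a + b)) ->
  side_order N (left_of w).
Proof.
  move=> sub nb.
  have tot x y : 0 < x <= N -> 0 < y <= N -> x != y ->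
      left_of w x y = ~~ left_of w y x.
    move=> hx hy; rewrite /left_of -leqNgt [RHS]leq_eqVlt.
    by rewrite (inj_in_eq (@index_inj _ 0 w)) ?sub // => /negPf->.
  split=> [x|x y z|x y hx hy hxy|a b hab hN].
  - exact: ltnn.
  - exact: ltn_trans.
  - by rewrite (tot x y) // orNb.
  - have /andP[a0 ab] := hab.
    have b0 : 0 < b := ltn_trans a0 ab.
    have bab : b < a + b by rewrite -[X in X < _]add0n ltn_add2r.
    have hb : 0 < b <= N by rewrite b0 (leq_trans (leq_addl a b)).
    have ha : 0 < a <= N by rewrite a0 (leq_trans (leq_addr b a)).
    have hs : 0 < a + b <= N by rewrite addn_gt0 a0.
    have := nb a b hab hN; rewrite /between (tot b a) ?(gtn_eqF ab) //.
    rewrite (tot b (a + b)) ?(ltn_eqF bab) //.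
    by case: (left_of w a b); case: (left_of w (a + b) b).
Qed.

Lemma one_line_uniq {n} (p : 'S_n) : uniq (one_line p).
Proof.
  by rewrite map_inj_uniq ?enum_uniq // => i j [] /val_inj /perm_inj.
Qed.

Lemma mem_one_line {n} (p : 'S_n) v : 0 < v <= n -> v \in one_line p.
Proof.
  case: v => // v hv; apply/mapP; exists ((p^-1)%g (Ordinal hv)).
    by rewrite mem_enum.
  by rewrite permKV.
Qed.

Theorem theorem1p3 (n : nat) (hn : 18 <= n) (p : 'S_n) :
  exists s : seq nat,
    [/\ subseq s (one_line p), size s = 3, monotone_seq s & two_additive s].
Proof.
  have mem18 v : 0 < v <= 18 -> v \in one_line p.
    by case/andP=> v0 v18; rewrite mem_one_line // v0 (leq_trans v18).
  (* 'I_19 is the range 0, ..., 18, so ordinals are used here as values. *)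
  pose bad (ab : 'I_19 * 'I_19) := let: (a, b) := (val ab.1, val ab.2) in
    [&& 0 < a < b, a + b <= 18 & between (left_of (one_line p)) a b (a + b)].
  have [[a b] /and3P[/= hab hN btw]|nobad] := pickP bad.
    have /andP[a0 ab] := hab.
    apply: (between_two_additive (one_line_uniq p) _ hab btw) => x.
    rewrite !inE => /or3P[] /eqP->; apply: mem18.
    - by rewrite a0 (leq_trans (leq_addr b a)).
    - by rewrite (ltn_trans a0 ab) (leq_trans (leq_addl a b)).
    - by rewrite addn_gt0 a0.
  case: (@no_side_order (left_of (one_line p))).
  apply: side_order_left_of => // a b hab hN; apply/negP=> btw.
  have ha : a < 19 by rewrite ltnS (leq_trans (leq_addr b a)).
  have hb : b < 19 by rewrite ltnS (leq_trans (leq_addl a b)).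
  by have := nobad (Ordinal ha, Ordinal hb); rewrite /bad /= hab hN btw.
Qed.
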